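(* Let $\mathbf{X}\in\mathbb{R}^{d\times d}$ be symmetric positive definite, let $t>0$, and let $f\in\mathcal{F}_{\mathbf{X}}^{\mathrm{BA}}(t)$. Let $x_\star\in\mathcal{X}_f$ be a global minimizer of $f$ for which the alignment property (A) in the definition of $\mathcal{F}_{\mathbf{X}}^{\mathrm{BA}}(t)$ holds. Let $\{x_k\}_{k\ge 0}$ be the iterates of the Ball Proximal Point Method (BPM) with radius $t$ applied to $f$, started at some $x_0\in\operatorname{dom} f$. Then: (i) For every $k\ge 0$: $\mathcal{X}_f\cap \mathcal{B}_{\mathbf{X}}(x_k,t)\neq\emptyset$ if and only if $x_{k+1}\in\mathcal{X}_f$. (ii) The sequence of distances $\{\|x_k-x_\star\|_{\mathbf{X}}\}_{k\ge 0}$ is non-increasing. In particular, for every $k\ge 2$ with $\mathcal{X}_f\cap\mathcal{B}_{\mathbf{X}}(x_k,t)=\emptyset$, $$\|x_{k+1}-x_\star\|_{\mathbf{X}}^2\le \|x_{k-2}-x_\star\|_{\mathbf{X}}^2-\frac{t^2}{3}.$$ (iii) If $K\ge 0$ is an integer with $\left\lfloor \frac{K}{3}\right\rfloor\ge \frac{3}{t^2}\|x_0-x_\star\|_{\mathbf{X}}^2$, then $x_K\in\mathcal{X}_f$.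
   Context: For a symmetric positive definite $\mathbf{X}\in\mathbb{R}^{d\times d}$ write $\langle x,y\rangle_{\mathbf{X}}=x^\top\mathbf{X}y$, $\|x\|_{\mathbf{X}}=\sqrt{x^\top\mathbf{X}x}$, and $\mathcal{B}_{\mathbf{X}}(x,t)=\{z\in\mathbb{R}^d:\|z-x\|_{\mathbf{X}}\le t\}$. For $f:\mathbb{R}^d\to\mathbb{R}\cup\{+\infty\}$, $\operatorname{dom} f=\{x: f(x)<+\infty\}$; $f$ is proper if $\operatorname{dom} f\ne\emptyset$ and closed if it is lower semicontinuous; $\mathcal{X}_f$ is the set of global minimizers of $f$. The (set-valued) ball-proximal (''broximal'') operator is $\mathrm{brox}^t_f(x)=\arg\min_{z\in\mathcal{B}_{\mathbf{X}}(x,t)}f(z)$. The set $\mathcal{X}_f+\mathcal{B}_{\mathbf{X}}(0,t)$ is the Minkowski sum. The class $\mathcal{F}_{\mathbf{X}}^{\mathrm{BA}}(t)$ of Broximal Aligned functions consists of all proper, closed $f:\mathbb{R}^d\to\mathbb{R}\cup\{+\infty\}$ such that both of the following hold. (A) There exists $x_\star\in\mathcal{X}_f$ such that for every $x\in\operatorname{dom} f\setminus(\mathcal{X}_f+\mathcal{B}_{\mathbf{X}}(0,t))$ and every $u\in\mathrm{brox}^t_f(x)$, $\langle x-u,\,x_\star-u\rangle_{\mathbf{X}}\le 0$. (B) For all $x\in\operatorname{dom} f$: if $\mathrm{brox}^t_f(x)=\{x\}$, then $x\in\mathcal{X}_f$. BPM with radius $t$: given $x_0\in\operatorname{dom} f$,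 iterate $x_{k+1}\in\mathrm{brox}^t_f(x_k)$ for $k\ge 0$. When $\mathrm{brox}^t_f(x_k)$ has several elements the algorithm may choose any of them, except that if $x_k\notin\mathcal{X}_f+\mathcal{B}_{\mathbf{X}}(0,t)$ and $\mathrm{brox}^t_f(x_k)$ contains a point other than $x_k$, it must choose $x_{k+1}\in\mathrm{brox}^t_f(x_k)\setminus\{x_k\}$ (for instance, a minimizer maximally distant from $x_k$).
   Formalization: In (ii), the distances are claimed non-increasing only at steps k where the ball around x_k contains no global minimizer; for all k it is false (f = 0, t = 1, x_0 = x_* = 0, x_1 = 1), since once the ball meets the minimizers the next iterate may be any minimizer in it. *)

(* Defs.v *)
From HB Require Import structures.
From mathcomp Require Import all_boot all_order all_algebra.
From mathcomp Require Import all_classical all_reals all_analysis.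
Set Implicit Arguments.
Unset Strict Implicit.
Unset Printing Implicit Defensive.
Import Order.TTheory GRing.Theory Num.Theory.
Import numFieldNormedType.Exports.
Local Open Scope classical_set_scope.
Local Open Scope ring_scope.

Definition dotX (R : realType) (d : nat) (X : 'M[R]_d) (x y : 'cV[R]_d) : R :=
  (x^T *m X *m y) 0 0.

Definition normX (R : realType) (d : nat) (X : 'M[R]_d) (x : 'cV[R]_d) : R :=
  Num.sqrt (dotX X x x).

Definition sym_posdef (R : realType) (d : nat) (X : 'M[R]_d) : Prop :=
  X^T = X /\ forall v : 'cV[R]_d, v != 0 -> 0 < dotX X v v.

Definition ballX (R : realType) (d : nat) (X : 'M[R]_d) (x : 'cV[R]_d) (t : R) :
  set 'cV[R]_d := [set z | normX X (z - x) <= t].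

Definition dom (R : realType) (d : nat) (f : 'cV[R]_d -> \bar R) :
  set 'cV[R]_d := [set x | (f x < +oo)%E].

Definition minimizers (R : realType) (d : nat) (f : 'cV[R]_d -> \bar R) :
  set 'cV[R]_d := [set x | forall y, (f x <= f y)%E].

Definition brox (R : realType) (d : nat) (X : 'M[R]_d) (t : R)
    (f : 'cV[R]_d -> \bar R) (x : 'cV[R]_d) : set 'cV[R]_d :=
  [set z | ballX X x t z /\ forall w, ballX X x t w -> (f z <= f w)%E].

Definition minkowski (R : realType) (d : nat) (A B : set 'cV[R]_d) :
  set 'cV[R]_d := [set a + b | a in A & b in B].

Definition near_minimizers (R : realType) (d : nat) (X : 'M[R]_d) (t : R)
    (f : 'cV[R]_d -> \bar R) : set 'cV[R]_d :=
  minkowski (minimizers f) (ballX X 0 t).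

Definition aligned (R : realType) (d : nat) (X : 'M[R]_d) (t : R)
    (f : 'cV[R]_d -> \bar R) (xs : 'cV[R]_d) : Prop :=
  forall x, (dom f `\` near_minimizers X t f) x ->
  forall u, brox X t f x u -> dotX X (x - u) (xs - u) <= 0.

(* f takes values in R U {+oo}; since \bar R also contains -oo, the first
   conjunct excludes it. *)
Definition broximal_aligned (R : realType) (d : nat) (X : 'M[R]_d) (t : R)
    (f : 'cV[R]_d -> \bar R) : Prop :=
  [/\ forall x, f x != -oo%E,
      dom f !=set0,
      lower_semicontinuous f,
      exists2 xs, minimizers f xs & aligned X t f xs
    & forall x, dom f x -> brox X t f x = [set x] -> minimizers f x].

Definition is_bpm (R : realType) (d : nat) (X : 'M[R]_d) (t : R)
    (f : 'cV[R]_d -> \bar R) (x : nat -> 'cV[R]_d) : Prop :=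
  dom f (x 0%N) /\
  forall k : nat,
    brox X t f (x k) (x k.+1) /\
    (~ near_minimizers X t f (x k) -> (brox X t f (x k) `\ x k) !=set0 ->
     x k.+1 <> x k).

(* Main.v *)
Require Import Defs.
From mathcomp Require Import all_boot all_order all_algebra.
From mathcomp Require Import all_classical all_reals all_analysis.
From mathcomp Require Import ring lra.
Import Order.TTheory GRing.Theory Num.Theory.
Import numFieldNormedType.Exports.
Local Open Scope classical_set_scope.
Local Open Scope ring_scope.


(** Every step is either final or obtuse. If the ball around [x k] contains a
    minimizer, then [x k.+1], which minimizes [f] on this ball, is a minimizer
    of [f], and so are all later iterates. Otherwise alignment says that the
    angle at [x k.+1] between [x k] and [xs] is at least a right angle, so the
    squared distance to [xs] drops by at least the squared step length
    ([aligned_step]).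

    Single steps may be short, but three consecutive ones cannot be. Were
    [x k.+3] within [t] of [x k], the optimality of [x k.+1] on the ball
    around [x k] would make [f] constant along [x k.+1], [x k.+2], [x k.+3].
    Then [x k.+1] and [x k.+2] would each be a broximal point of the other,
    and the two alignment inequalities would add up to
    [|x k.+1 - x k.+2|^2 <= 0] ([aligned_mutual_brox]). But an iterate outside
    the near-minimizers always moves, by property (B) and the selection rule
    ([bpm_moves]). So the three steps add up to a vector longer than [t]
    ([bpm_three_steps_far]), and the convexity of the squared norm bounds the
    sum of the three squared lengths below by [t^2 / 3]. After [n] blocks of
    three steps without reaching a minimizer, the initial squared distance has
    paid [n t^2 / 3], which is the complexity bound. *)

Set Implicit Arguments.
Unset Strict Implicit.

(** * The inner product of a positive definite matrix *)

Section InnerProduct.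
Context {R : realType} {d : nat} {X : 'M[R]_d}.
Implicit Types u v w : 'cV[R]_d.

Lemma dotXBl u v w : dotX X (u - v) w = dotX X u w - dotX X v w.
Proof. by rewrite /dotX linearB /= !mulmxBl !mxE. Qed.

Lemma dotXBr u v w : dotX X u (v - w) = dotX X u v - dotX X u w.
Proof. by rewrite /dotX mulmxBr !mxE. Qed.

Lemma dotX0 : dotX X 0 0 = 0.
Proof. by rewrite /dotX mulmx0 mxE. Qed.

Lemma normXC u v : normX X (u - v) = normX X (v - u).
Proof.
by rewrite /normX !dotXBl !dotXBr; congr (Num.sqrt _); ring.
Qed.

Hypothesis hX : sym_posdef X.

Lemma dotXC u v : dotX X u v = dotX X v u.
Proof.
rewrite /dotX -[in LHS](trmxK (u^T *m X *m v)) mxE.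
by rewrite !trmx_mul trmxK hX.1 mulmxA.
Qed.

Lemma dotX_ge0 v : 0 <= dotX X v v.
Proof.
by have [->|v0] := eqVneq v 0; [rewrite dotX0 | exact/ltW/hX.2].
Qed.

Lemma sqr_normX v : normX X v ^+ 2 = dotX X v v.
Proof. by rewrite sqr_sqrtr // dotX_ge0. Qed.

Lemma dotX_le0_eq0 v : dotX X v v <= 0 -> v = 0.
Proof.
by move=> v_le0; apply/eqP; apply: contraTT v_le0; rewrite -ltNge; exact: hX.2.
Qed.

Lemma ballX_center v t : 0 < t -> ballX X v t v.
Proof. by move=> t0; rewrite /ballX /= /normX subrr dotX0 sqrtr0 ltW. Qed.

(** Both sides differ by the sum of the squared norms of the pairwise
    differences of the three steps. *)
Lemma sqr_normX_three_steps u v w z :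
  normX X (u - z) ^+ 2 <=
  3 * (normX X (u - v) ^+ 2 + normX X (v - w) ^+ 2 + normX X (w - z) ^+ 2).
Proof.
have := dotX_ge0 ((u - v) - (v - w)).
have := dotX_ge0 ((v - w) - (w - z)).
have := dotX_ge0 ((u - v) - (w - z)).
rewrite !sqr_normX !dotXBl !dotXBr.
rewrite (dotXC v u) (dotXC w u) (dotXC z u) (dotXC w v) (dotXC z v) (dotXC z w).
lra.
Qed.

(** The law of cosines at [v]. *)
Lemma sqr_normX_obtuse u v w : dotX X (u - v) (w - v) <= 0 ->
  normX X (v - w) ^+ 2 <= normX X (u - w) ^+ 2 - normX X (u - v) ^+ 2.
Proof.
rewrite !sqr_normX !dotXBl !dotXBr (dotXC v u) (dotXC w u) (dotXC w v).
lra.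
Qed.

End InnerProduct.

(** * Alignment away from the near-minimizers *)

Section Aligned.
Context {R : realType} {d : nat} {X : 'M[R]_d} {t : R} {f : 'cV[R]_d -> \bar R}.
Hypotheses (hX : sym_posdef X) (t_gt0 : 0 < t).
Implicit Types u v x y : 'cV[R]_d.

Lemma near_minimizersP x :
  near_minimizers X t f x <-> (minimizers f `&` ballX X x t) !=set0.
Proof.
split=> [[m mmin [b bt <-]]|[m [mmin mt]]].
- exists m; split => //; move: bt; rewrite /ballX /= subr0 normXC.
  by rewrite addrAC subrr add0r.
- exists m => //; exists (x - m); last by rewrite addrCA subrr addr0.
  by rewrite /ballX /= subr0 normXC.
Qed.

Lemma minimizers_near x : minimizers f x -> near_minimizers X t f x.
Proof.
by move=> xmin; apply/near_minimizersP; exists x; split => //; exact: ballX_center.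
Qed.

Lemma brox_near x u :
  brox X t f x u -> near_minimizers X t f x <-> minimizers f u.
Proof.
move=> [ut umin]; rewrite near_minimizersP; split=> [[m [mmin mt]] y|uM].
- exact: le_trans (umin _ mt) (mmin y).
- by exists u.
Qed.

Lemma brox_le x u : brox X t f x u -> (f u <= f x)%E.
Proof. by move=> [_]; apply; exact: ballX_center. Qed.

Lemma brox_dom x u : dom f x -> brox X t f x u -> dom f u.
Proof. by move=> xdom /brox_le ux; exact: le_lt_trans xdom. Qed.

Context {xs : 'cV[R]_d}.
Hypothesis hA : aligned X t f xs.

Lemma aligned_step x u : dom f x -> ~ near_minimizers X t f x ->
  brox X t f x u ->
  normX X (u - xs) ^+ 2 <= normX X (x - xs) ^+ 2 - normX X (x - u) ^+ 2.
Proof. by move=> xd xn xu; apply: sqr_normX_obtuse => //; exact: hA. Qed.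

(** A triangle cannot have two angles that are both at least right. *)
Lemma aligned_mutual_brox x y : dom f x -> dom f y ->
  ~ near_minimizers X t f x -> ~ near_minimizers X t f y ->
  brox X t f x y -> brox X t f y x -> x = y.
Proof.
move=> xd yd xn yn xy yx.
have /(sqr_normX_obtuse hX) xyle := hA (conj xd xn) xy.
have /(sqr_normX_obtuse hX) yxle := hA (conj yd yn) yx.
apply/eqP; rewrite -subr_eq0; apply/eqP/(dotX_le0_eq0 hX).
rewrite -(sqr_normX hX); move: xyle yxle; rewrite (normXC y x); lra.
Qed.

End Aligned.

(** * The iterates *)

Section Iterates.
Context {R : realType} {d : nat} {X : 'M[R]_d} {t : R} {f : 'cV[R]_d -> \bar R}.
Context {xs : 'cV[R]_d} {x : nat -> 'cV[R]_d}.
Hypotheses (hX : sym_posdef X) (t_gt0 : 0 < t).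
Hypothesis hB : forall y, dom f y -> brox X t f y = [set y] -> minimizers f y.
Hypothesis hA : aligned X t f xs.
Hypothesis hx : is_bpm X t f x.

Let near k := near_minimizers X t f (x k).

Let bpm_brox k : brox X t f (x k) (x k.+1).
Proof. exact: (hx.2 k).1. Qed.

Lemma bpm_dom k : dom f (x k).
Proof.
elim: k => [|k IH]; first exact: hx.1.
exact: brox_dom IH (bpm_brox k).
Qed.

Lemma bpm_nearS k : near k <-> minimizers f (x k.+1).
Proof. exact: brox_near (bpm_brox k). Qed.

Lemma bpm_minimizers_le j k : (j <= k)%N ->
  minimizers f (x j) -> minimizers f (x k).
Proof.
move=> /subnK <-; elim: (k - j)%N => [//|n IH] /IH xmin.
by apply/bpm_nearS; exact: minimizers_near.
Qed.

Lemma bpm_near_le j k : (j <= k)%N -> near j -> near k.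
Proof.
move=> jk /bpm_nearS xmin; apply/bpm_nearS.
exact: bpm_minimizers_le xmin.
Qed.

Lemma bpm_moves k : ~ near k -> x k.+1 <> x k.
Proof.
move=> nk; apply: (hx.2 k).2 => //.
(* Otherwise the broximal set has no point but [x k]; as it contains [x k.+1],
   it is the singleton of [x k], and property (B) applies. *)
apply/set0P/negP => /eqP; rewrite setD_eq0 => sub; apply: nk.
apply: (minimizers_near t_gt0); apply: hB; first exact: bpm_dom.
apply/seteqP; split=> // _ ->.
by have xk := bpm_brox k; rewrite -{2}(sub _ xk).
Qed.

(** The values of [f] decrease strictly over any two steps, for otherwise
    [x k] and [x k.+1] would be broximal points of each other. *)
Lemma bpm_two_steps_lt k : ~ near k.+1 -> (f (x k.+2) < f (x k))%E.
Proof.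
move=> nk1; rewrite ltNge; apply/negP => le02.
have nk : ~ near k by apply: contra_not nk1; exact: bpm_near_le.
have back : brox X t f (x k.+1) (x k).
  split; first by move: (bpm_brox k).1; rewrite /ballX /= normXC.
  by move=> w /(bpm_brox k.+1).2; exact: le_trans.
apply: (bpm_moves nk); apply/esym.
by apply: (aligned_mutual_brox hX hA) => //; exact: bpm_dom.
Qed.

(** If [x k.+3] were in the ball around [x k], then its value would be at
    least the one of [x k.+1], which minimizes [f] on this ball. *)
Lemma bpm_three_steps_far k : ~ near k.+2 -> t < normX X (x k - x k.+3).
Proof.
move=> /bpm_two_steps_lt lt13; rewrite ltNge normXC; apply/negP => x3t.
by move: lt13; rewrite ltNge ((bpm_brox k).2 _ x3t).
Qed.

Lemma bpm_step k : ~ near k ->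
  normX X (x k.+1 - xs) ^+ 2 <=
  normX X (x k - xs) ^+ 2 - normX X (x k - x k.+1) ^+ 2.
Proof. move=> nk; exact: (aligned_step hX hA (bpm_dom k) nk (bpm_brox k)). Qed.

Lemma bpm_three_steps k : ~ near k.+2 ->
  normX X (x k.+3 - xs) ^+ 2 <= normX X (x k - xs) ^+ 2 - t ^+ 2 / 3.
Proof.
move=> nk2.
have nk1 : ~ near k.+1 by apply: contra_not nk2; exact: bpm_near_le.
have nk : ~ near k by apply: contra_not nk1; exact: bpm_near_le.
have far : t ^+ 2 <= normX X (x k - x k.+3) ^+ 2.
  by rewrite lerXn2r ?nnegrE ?sqrtr_ge0 ?ltW //; exact: bpm_three_steps_far.
have := sqr_normX_three_steps hX (x k) (x k.+1) (x k.+2) (x k.+3).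
have := bpm_step nk; have := bpm_step nk1; have := bpm_step nk2.
lra.
Qed.

Lemma bpm_blocks n : ~ minimizers f (x (3 * n)%N) ->
  normX X (x (3 * n)%N - xs) ^+ 2 <=
  normX X (x 0%N - xs) ^+ 2 - n%:R * (t ^+ 2 / 3).
Proof.
elim: n => [|n IH]; first by rewrite muln0 mul0r subr0.
rewrite mulnS addnC addn3 => nmin.
have nmin0 : ~ minimizers f (x (3 * n)%N).
  by apply: contra_not nmin; exact/bpm_minimizers_le/(leq_addl 3).
have nn : ~ near (3 * n).+2 by move=> /bpm_nearS.
have := IH nmin0; have := bpm_three_steps nn.
rewrite -natr1; lra.
Qed.

End Iterates.

Unset Implicit Arguments.
Set Strict Implicit.

(* Monotonicity of the distances is stated for the steps with
   minimizers f `&` ballX X (x k) t = set0. Once the ball contains a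
   minimizer, x k.+1 may be any minimizer in the ball and its distance to xs
   can increase (e.g. f constant and x 0 = xs). *)
Theorem theorem4p1 (R : realType) (d : nat) (X : 'M[R]_d) (t : R)
    (f : 'cV[R]_d -> \bar R) (xs : 'cV[R]_d) (x : nat -> 'cV[R]_d)
    (hX : sym_posdef X) (ht : 0 < t)
    (hf : broximal_aligned X t f)
    (hxs : minimizers f xs) (hA : aligned X t f xs)
    (hx : is_bpm X t f x) :
  (* (i) *)
  (forall k : nat,
     (minimizers f `&` ballX X (x k) t) !=set0 <-> minimizers f (x k.+1)) /\
  (* (ii) *)
  ((forall k : nat, minimizers f `&` ballX X (x k) t = set0 ->
      normX X (x k.+1 - xs) <= normX X (x k - xs)) /\
   (forall k : nat, (2 <= k)%N -> minimizers f `&` ballX X (x k) t = set0 ->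
      normX X (x k.+1 - xs) ^+ 2
        <= normX X (x (k - 2)%N - xs) ^+ 2 - t ^+ 2 / 3)) /\
  (* (iii) *)
  (forall K : nat,
     3 / t ^+ 2 * normX X (x 0%N - xs) ^+ 2 <= (K %/ 3)%:R ->
     minimizers f (x K)).
Proof.
have [_ _ _ _ hB] := hf.
have out k : minimizers f `&` ballX X (x k) t = set0 ->
    ~ near_minimizers X t f (x k).
  by move=> e /near_minimizersP; rewrite e => /set0P/eqP.
split; [|split; [split|]].
- by move=> k; rewrite -near_minimizersP; exact: (bpm_nearS hx).
- move=> k /out nk; apply: ler_wsqrtr; rewrite -!(sqr_normX hX).
  apply: le_trans (bpm_step hX ht hA hx nk) _.
  by rewrite gerBl sqr_ge0.
- move=> [|[|k]] // _ /out nk; rewrite subn2 /=.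
  exact: (bpm_three_steps hX ht hB hA hx nk).
- move=> K hK; apply: contrapT => nK.
  (* The blocks have used up the whole distance, so the last one ends at
     [xs] itself. *)
  have nn : ~ minimizers f (x (3 * (K %/ 3))%N).
    apply: contra_not nK; apply: (bpm_minimizers_le ht hx).
    by rewrite mulnC leq_trunc_div.
  apply: (nn); suff /eqP : x (3 * (K %/ 3))%N - xs = 0.
    by rewrite subr_eq0 => /eqP ->.
  apply: (dotX_le0_eq0 hX); rewrite -(sqr_normX hX).
  apply: le_trans (bpm_blocks hX ht hB hA hx nn) _.
  rewrite subr_le0 -ler_pdivrMr ?divr_gt0 ?exprn_gt0 //.
  by rewrite invf_div mulrC.
Qed.
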